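(* For all integers $n \geq 0$ and $l \geq 0$, one has \[\sum_{i=0}^{l} \binom{n-i}{i}\binom{l+i}{2i+1}=\sum_{i=0}^{l} \binom{n-i}{i-1}\binom{l+i}{2i}.\]
   Context: Convention for binomial coefficients $\binom{m}{j}$ with $m, j \in \mathbb{Z}$: if $m \geq 0$, then $\binom{m}{j}$ is the usual binomial coefficient for $0 \leq j \leq m$, and $\binom{m}{j}=0$ if $j<0$ or $j>m$. If $m<0$, then $\binom{m}{j}:=(-1)^{j}\binom{j-m-1}{j}$ if $j \geq 0$, and $\binom{m}{j}:=0$ if $j<0$. Equivalently, $\binom{m}{j}=\frac{m(m-1)\cdots(m-j+1)}{j!}$ for $j \geq 0$ and $\binom{m}{j}=0$ for $j<0$. *)

(* Defs.v *)
From mathcomp Require Import all_boot all_order all_algebra.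

Set Implicit Arguments.
Unset Strict Implicit.
Unset Printing Implicit Defensive.

Import Order.TTheory GRing.Theory Num.Theory.
Local Open Scope ring_scope.

(* Binomial coefficient with integer entries.  absz only converts from int to
   nat: in each branch its arguments are nonnegative. *)
Definition binz (m j : int) : int :=
  if j < 0 then 0
  else if 0 <= m then 'C(absz m, absz j)%:Z
  else (-1) ^+ absz j * 'C(absz (j - m - 1)%R, absz j)%:Z.

(* Main.v *)
Require Import Defs.
From mathcomp Require Import all_boot all_order all_algebra.
From mathcomp Require Import zify ring.

Set Implicit Arguments.
Unset Strict Implicit.

Import Order.TTheory GRing.Theory Num.Theory.
Local Open Scope ring_scope.

(** Put z = x / (1 - x)^2 and t = 1 / (1 - x), so that t^2 = t + z, and
    A_n(z) = sum_i C(n - i, i) z^i.  In generating functions over l the two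
    sides become z A_n and t z A_(n-1), and A_n / (1 - x) equals
    1 / ((1 + x) (1 - x)^(n+1)).  The coefficients of the latter are the
    iterated partial sums of (-1)^l, and they match those of the former by
    induction on n from A_n = A_(n-1) + z A_(n-2). *)

Lemma binz_nat (m k : nat) : binz m%:Z k%:Z = 'C(m, k)%:Z.
Proof. by []. Qed.

Lemma binz_neg (m k : nat) :
  binz (- (m.+1)%:Z) k%:Z = (-1) ^+ k * 'C(k + m, k)%:Z.
Proof.
rewrite /binz /=; congr (_ * _); congr (Posz 'C(_, _)); lia.
Qed.

Lemma binz0 (m : int) : binz m 0 = 1.
Proof.
by case: m => m; rewrite ?NegzE -[0]/(0%:Z) ?binz_nat ?binz_neg !bin0 ?mul1r.
Qed.

Lemma binz_pascal (m : int) (k : nat) :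
  binz (m + 1) k.+1%:Z = binz m k.+1%:Z + binz m k%:Z.
Proof.
case: m => [m|[|m]].
- by rewrite (_ : m%:Z + 1 = m.+1%:Z) ?binz_nat ?binS //; lia.
(* Here m = -1, and m + 1 = 0 leaves the negative branch of [binz]. *)
- rewrite (_ : Negz 0 + 1 = 0%:Z) // NegzE !binz_neg binz_nat.
  by rewrite !addn0 !binn bin_small // exprS; ring.
- rewrite (_ : Negz m.+1 + 1 = - m.+1%:Z) ?NegzE; last by lia.
  by rewrite !binz_neg !addnS !addSn (binS _.+1) exprS PoszD; ring.
Qed.

(* Indexed so that [diagbin n.+1] is the coefficient sequence of [A_n]: the
   induction starts at A_(-1), whose coefficients are central binomials. *)
Definition diagbin (n i : nat) : int := binz (n%:Z - 1 - i%:Z) i%:Z.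

Lemma diagbin0 n : diagbin n 0 = 1.
Proof. exact: binz0. Qed.

Lemma diagbin_rec n i :
  diagbin n.+2 i.+1 = diagbin n.+1 i.+1 + diagbin n i.
Proof.
rewrite /diagbin.
rewrite (_ : n.+2%:Z - 1 - i.+1%:Z = n%:Z - 1 - i%:Z + 1); last by lia.
by rewrite binz_pascal; congr (binz _ _ + _); lia.
Qed.

Lemma diagbin_central i : diagbin 0 i = (-1) ^+ i * 'C(i.*2, i)%:Z.
Proof.
rewrite /diagbin (_ : 0%:Z - 1 - i%:Z = - i.+1%:Z); last by lia.
by rewrite binz_neg addnn.
Qed.

(** Up to sign, this is C(2i, i) = 2 C(2i - 1, i) for i > 0, by Pascal's rule and symmetry; it
    amounts to 2 A_0 = A_(-1) + 1. *)
Lemma diagbin1_double i : 2 * diagbin 1 i = diagbin 0 i + (i == 0%N)%:Z.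
Proof.
case: i => [|i]; first by rewrite !diagbin0.
rewrite diagbin_central /diagbin.
rewrite (_ : 1%:Z - 1 - i.+1%:Z = - i.+1%:Z); last by lia.
rewrite binz_neg doubleS (binS i.*2.+1) (_ : i.+1 + i = i.*2.+1)%N; last by lia.
have -> : 'C(i.*2.+1, i) = 'C(i.*2.+1, i.+1).
  have le_i : (i <= i.*2.+1)%N by lia.
  by rewrite -(bin_sub le_i); congr 'C(_, _); lia.
by rewrite PoszD /= addr0; ring.
Qed.

(** Up to sign, the sum is the l-th forward difference of C(x, k + l) at x = m; each difference
    lowers the bottom index by one. *)
Lemma alternating_bin_sum (l m k : nat) :
  \sum_(0 <= i < l.+1) (-1) ^+ i * ('C(l, i)%:Z * 'C(m + i, k + l)%:Z)
  = (-1) ^+ l * 'C(m, k)%:Z :> int.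
Proof.
elim: l k => [|l IH] k.
  by rewrite big_nat1 bin0 !addn0 !mul1r.
rewrite big_nat_recl // bin0 addn0.
under eq_bigr => i _ do rewrite binS PoszD mulrDl mulrDr.
rewrite big_split /= addrA.
have -> : 1 * (1%:Z * 'C(m, k + l.+1)%:Z) + \sum_(0 <= i < l.+1) (-1) ^+ i.+1 *
    ('C(l, i.+1)%:Z * 'C(m + i.+1, k + l.+1)%:Z)
  = \sum_(0 <= i < l.+1) (-1) ^+ i * ('C(l, i)%:Z * 'C(m + i, k + l.+1)%:Z) :> int.
  rewrite [RHS]big_nat_recl // bin0 addn0; congr (_ + _).
  by rewrite big_nat_recr //= bin_small // mul0r mulr0 addr0.
rewrite -big_split /= exprS -mulrA -IH mulr_sumr; apply: eq_bigr => i _.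
by rewrite !addnS binS PoszD exprS; ring.
Qed.

(** For i <= l both sides are the multinomial (l + i)! / (i! i! (l - i)!). *)
Lemma bin_central_trinomial (l i : nat) :
  ('C(i.*2, i) * 'C(l + i, i.*2) = 'C(l, i) * 'C(l + i, l))%N.
Proof.
case: (leqP i l) => il; last by rewrite (bin_small il) (@bin_small (l + i)) ?muln0 //; lia.
have le2 : (i.*2 <= l + i)%N by lia.
apply/eqP; rewrite -(@eqn_pmul2r (i`! * (i`! * (l - i)`!))); last first.
  by rewrite !muln_gt0 !fact_gt0.
have e1 := bin_fact le2.
have e2 := bin_fact (_ : i <= i.*2)%N.
have e3 := bin_fact il.
have e4 := bin_fact (leq_addr i l).
rewrite (_ : l + i - i.*2 = l - i)%N in e1; last by lia.
rewrite (_ : i.*2 - i = i)%N in e2; last by lia.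
rewrite (_ : l + i - l = i)%N in e4; last by lia.
have {}e2 := e2 ltac:(lia).
apply/eqP; move: e1 e2 e3 e4.
move: 'C(_, _) 'C(_, _) 'C(_, _) 'C(_, _) => a b c d e1 e2 e3 e4.
transitivity ((l + i)`!); first by rewrite -e1 -e2; ring.
by rewrite -e4 -e3; ring.
Qed.

(* Coefficient of x^l in 1 / ((1 + x) (1 - x)^n). *)
Fixpoint altsum (n l : nat) : int :=
  if n is n'.+1 then \sum_(0 <= k < l.+1) altsum n' k else (-1) ^+ l.

Lemma altsum_rec n l : altsum n.+1 l.+1 = altsum n.+1 l + altsum n l.+1.
Proof. by rewrite /= big_nat_recr. Qed.

Lemma altsum_base n : altsum n 0 = 1.
Proof. by elim: n => //= n IH; rewrite big_nat1. Qed.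

(** Partial fractions: 2 / ((1 + x) (1 - x)) = 1 / (1 + x) + 1 / (1 - x). *)
Lemma altsum1_double l : 2 * altsum 1 l = altsum 0 l + 1.
Proof.
elim: l => [|l IH]; first by rewrite !altsum_base.
by rewrite altsum_rec mulrDr IH /= exprS; ring.
Qed.

(* For d = 0, 1, 2 the generating function over l is that of [A_(n-1)] times
   t, z and t z respectively.  The common bound [M] on the summation index
   only has to exceed [l]. *)
Definition diagsum (d M n l : nat) : int :=
  \sum_(0 <= i < M) diagbin n i * 'C(l + d./2 + i, i.*2 + d)%:Z.

(** On coefficients, (1 - x) z = x t; likewise (1 - x) t z = z in [diagsum2S]. *)
Lemma diagsum1S M n l :
  diagsum 1 M n l.+1 = diagsum 1 M n l + diagsum 0 M n l.
Proof.
rewrite /diagsum -big_split /=; apply: eq_bigr => i _.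
by rewrite !addn0 addn1 addSn binS PoszD mulrDr.
Qed.

Lemma diagsum2S M n l :
  diagsum 2 M n l.+1 = diagsum 2 M n l + diagsum 1 M n l.+1.
Proof.
rewrite /diagsum -big_split /=; apply: eq_bigr => i _.
by rewrite !addn0 !addn1 addn2 !addSn binS PoszD mulrDr.
Qed.

Lemma diagsum_at0 d M n : (0 < d)%N -> diagsum d M n 0 = 0.
Proof.
move=> d0; rewrite /diagsum big1_seq // => i _.
by rewrite bin_small ?mulr0 //; lia.
Qed.

Lemma diagsum0_rec M n l : (l < M)%N ->
  diagsum 0 M n.+2 l = diagsum 0 M n.+1 l + diagsum 2 M n l.
Proof.
case: M => // M lM; rewrite /diagsum [LHS]big_nat_recl // [X in _ = X + _]big_nat_recl //.
rewrite !diagbin0 -addrA.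
congr (_ + _).
rewrite [X in _ = _ + X]big_nat_recr //=.
(* The last term of the d = 2 sum vanishes because l is below the bound. *)
rewrite [X in _ + (_ + X)](_ : _ = 0) ?addr0; last first.
  by rewrite bin_small ?mulr0 //; lia.
rewrite -big_split /=; apply: eq_bigr => i _.
rewrite diagbin_rec !addn0 (_ : l + 1 + i = l + i.+1)%N; last by lia.
by rewrite addn2 doubleS; ring.
Qed.

(** A_(-1) = (1 + 4z)^(-1/2) = (1 - x) / (1 + x), so t A_(-1) = 1 / (1 + x). The proof obtains this
    as an l-th difference, through [bin_central_trinomial]. *)
Lemma diagsum0_central M l : (l < M)%N -> diagsum 0 M 0 l = (-1) ^+ l.
Proof.
move=> lM; rewrite /diagsum (big_cat_nat (n := l.+1)) //=.
rewrite [X in _ + X]big1_seq ?addr0; last first.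
  move=> i; rewrite mem_index_iota => /andP[_ /andP[li _]].
  by rewrite bin_small ?mulr0 //; lia.
have := alternating_bin_sum l l 0; rewrite bin0 mulr1 => <-.
apply: eq_bigr => i _.
by rewrite diagbin_central !addn0 -mulrA -!PoszM bin_central_trinomial.
Qed.

Lemma diagsum0_one M l : (l < M)%N -> diagsum 0 M 1 l = altsum 1 l.
Proof.
move=> lM; apply: (@mulfI _ (2 : int)) => //.
rewrite altsum1_double /= -(diagsum0_central lM) /diagsum mulr_sumr.
under eq_bigr => i _ do rewrite mulrA diagbin1_double mulrDl.
rewrite big_split /=; congr (_ + _).
case: M lM => // M _; rewrite big_nat_recl // big1 => [|i _].
  by rewrite bin0.
by rewrite mul0r.
Qed.

(** Passing from t to z = x t / (1 - x) takes partial sums and shifts l by one. *)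
Lemma diagsum1_altsum M n :
    (forall l, (l < M)%N -> diagsum 0 M n l = altsum n l) ->
  forall l, (l < M)%N -> diagsum 1 M n l.+1 = altsum n.+1 l.
Proof.
move=> H; elim=> [|l IH] lM; rewrite diagsum1S H //.
  by rewrite diagsum_at0 // !altsum_base.
by rewrite IH ?altsum_rec // ltnW.
Qed.

Lemma diagsum2_altsum M n :
    (forall l, (l < M)%N -> diagsum 0 M n l = altsum n l) ->
  forall l, (l < M)%N -> diagsum 2 M n l.+1 = altsum n.+2 l.
Proof.
move=> H; elim=> [|l IH] lM; rewrite diagsum2S (diagsum1_altsum H) //.
  by rewrite diagsum_at0 // !altsum_base.
by rewrite IH ?[RHS]altsum_rec // ltnW.
Qed.

Lemma diagsum0_altsum M n l : (l < M)%N -> diagsum 0 M n l = altsum n l.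
Proof.
move: l; elim/ltn_ind: n => -[|[|n]] IH l lM.
- exact: diagsum0_central.
- exact: diagsum0_one.
rewrite diagsum0_rec // IH //; case: l lM => [|l] lM.
  by rewrite diagsum_at0 // !altsum_base.
(* The d = 2 sum for n at l + 1 is [altsum n.+2 l], so the recurrence of [altsum] closes the
   induction. *)
rewrite (@diagsum2_altsum M n) ?[RHS]altsum_rec 1?addrC //; last exact: ltnW.
by move=> k; apply: IH; lia.
Qed.

Theorem mainTheorem2 (n l : nat) :
  \sum_(0 <= i < l.+1)
     binz (n%:Z - i%:Z) i%:Z * binz (l%:Z + i%:Z) (2 * i%:Z + 1)
  = \sum_(0 <= i < l.+1)
     binz (n%:Z - i%:Z) (i%:Z - 1) * binz (l%:Z + i%:Z) (2 * i%:Z).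
Proof.
transitivity (diagsum 1 l.+1 n.+1 l).
  apply: eq_bigr => i _; rewrite /diagbin (_ : n.+1%:Z - 1 = n%:Z); last by lia.
  rewrite -PoszD (_ : 2 * i%:Z + 1 = (i.*2 + 1)%N%:Z); last by lia.
  by rewrite binz_nat /= addn0.
(* The term i = 0 on the right vanishes, its first factor having lower index -1. After the shift,
   the extra term i = l of [diagsum] contains C(2l + 1, 2l + 2) = 0. *)
transitivity (diagsum 2 l.+1 n l); last first.
  rewrite big_nat_recl // mul0r add0r /diagsum big_nat_recr //=.
  rewrite [X in _ + X](_ : _ = 0) ?addr0; last first.
    by rewrite bin_small ?mulr0 //; lia.
  apply: eq_bigr => i _; rewrite /diagbin -PoszD.
  rewrite (_ : n%:Z - i.+1%:Z = n%:Z - 1 - i%:Z); last by lia.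
  rewrite (_ : i.+1%:Z - 1 = i%:Z); last by lia.
  rewrite (_ : 2 * i.+1%:Z = (i.*2 + 2)%N%:Z); last by lia.
  by rewrite binz_nat (_ : l + 1 + i = l + i.+1)%N //; lia.
(* For l > 0 both sums equal [altsum n.+2] at l - 1. *)
case: l => [|l]; first by rewrite !diagsum_at0.
by rewrite diagsum1_altsum ?diagsum2_altsum // => *; apply: diagsum0_altsum.
Qed.
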